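(* Let $n\ge1$ be an integer, $\alpha\in(0,1]$, $\beta>0$, and let $p_0,p_1,\dots,p_{n-1}$ be real constants. Suppose that $\{r_j\}_{j=1}^{k}$ are $k$ distinct roots, of multiplicities $\{\mu_j\}_{j=1}^{k}$, and that $\{\lambda_j,\bar\lambda_j\}_{j=1}^{m}$, $\lambda_j=a_j+ib_j$ ($a_j,b_j\in\mathbb{R}$, $b_j\neq0$), are $2m$ distinct roots, of multiplicities $\{\sigma_j\}_{j=1}^{m}$ ($\lambda_j$ and $\bar\lambda_j$ each having multiplicity $\sigma_j$), of the characteristic equation $$r^n+p_{n-1}r^{n-1}+\dots+p_1r+p_0=0,$$ such that $\sum_{j=1}^k\mu_j+2\sum_{j=1}^m\sigma_j=n$. Then the functions of $t>0$ $$\bigcup_{j=1}^{k}\Big\{\Big(\tfrac{\Gamma(\beta+1)}{\alpha}t^{\alpha}\Big)^{l}e^{\frac{r_j\Gamma(\beta+1)}{\alpha}t^{\alpha}}\Big\}_{l=0}^{\mu_j-1},$$ $$\bigcup_{j=1}^{m}\Big\{\Big(\tfrac{\Gamma(\beta+1)}{\alpha}t^{\alpha}\Big)^{l}e^{\frac{a_j\Gamma(\beta+1)}{\alpha}t^{\alpha}}\Big[\cos\Big(\tfrac{b_j\Gamma(\beta+1)}{\alpha}t^{\alpha}\Big)+i\sin\Big(\tfrac{b_j\Gamma(\beta+1)}{\alpha}t^{\alpha}\Big)\Big]\Big\}_{l=0}^{\sigma_j-1}$$ and $$\bigcup_{j=1}^{m}\Big\{\Big(\tfrac{\Gamma(\beta+1)}{\alpha}t^{\alpha}\Big)^{l}e^{\frac{a_j\Gamma(\beta+1)}{\alpha}t^{\alpha}}\Big[\cos\Big(\tfrac{b_j\Gamma(\beta+1)}{\alpha}t^{\alpha}\Big)-i\sin\Big(\tfrac{b_j\Gamma(\beta+1)}{\alpha}t^{\alpha}\Big)\Big]\Big\}_{l=0}^{\sigma_j-1}$$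 are a fundamental set of solutions of the equation $${}^{n}D^{\alpha,\beta}_{M}y+p_{n-1}\,{}^{n-1}D^{\alpha,\beta}_{M}y+\dots+p_{1}\,D^{\alpha,\beta}_{M}y+p_{0}\,y=0.$$
   Context: For $\beta>0$, $\mathbb{E}_\beta(z)=\sum_{k=0}^{\infty}\frac{z^k}{\Gamma(\beta k+1)}$ is the one-parameter Mittag-Leffler function. For $0<\alpha\le 1$, $\beta>0$, the $M$-fractional derivative of order $\alpha$ of a (real- or complex-valued) function $f$ at a point $t>0$ is $$D^{\alpha,\beta}_{M}f(t)=\lim_{\epsilon\to0}\frac{f\big(t\,\mathbb{E}_\beta(\epsilon t^{-\alpha})\big)-f(t)}{\epsilon},$$ with real $\epsilon$, and $f$ is $M$-differentiable at $t$ if this limit exists. ${}^{k}D^{\alpha,\beta}_{M}$ denotes $D^{\alpha,\beta}_{M}$ iterated $k$ times. A solution is an $n$ times $M$-differentiable (complex-valued) function on $(0,\infty)$ satisfying the equation there. A set $\{y_1,\dots,y_n\}$ of $n$ solutions is a fundamental set of solutions if every solution can be written as $c_1y_1+\dots+c_ny_n$ with (complex) constants $c_1,\dots,c_n$. *)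

(* Defs.v *)
From HB Require Import structures.
From mathcomp Require Import all_boot all_order all_algebra complex.
From mathcomp Require Import all_classical all_reals all_analysis.

Set Implicit Arguments.
Unset Strict Implicit.
Unset Printing Implicit Defensive.

Import Order.TTheory GRing.Theory Num.Theory.
Import numFieldNormedType.Exports.

Local Open Scope classical_set_scope.
Local Open Scope ring_scope.
Local Open Scope complex_scope.

Definition Gamma (R : realType) (x : R) : R :=
  \int[lebesgue_measure]_(s in `]0%R, +oo[) (s `^ (x - 1) * expR (- s)).

(* Real arguments are enough: the M-derivative only evaluates the
   Mittag-Leffler function on the real line. *)
Definition mittag_leffler (R : realType) (beta z : R) : R :=
  limn (series (fun k : nat => z ^+ k / Gamma (beta * k%:R + 1))).

Definition cexp (R : realType) (z : R[i]) : R[i] :=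
  (expR (complex.Re z))%:C * (cos (complex.Im z) +i* sin (complex.Im z)).

Section MDerivative.
Variables (R : realType) (alpha beta : R).
Implicit Types (f y : R -> R[i]) (t : R).

(* The alias R[i]^o carries the usual (modulus) topology of R[i]. *)
Definition Mquotient f t (eps : R) : R[i]^o :=
  (f (t * mittag_leffler beta (eps * t `^ (- alpha))) - f t) / eps%:C.

Definition Mdifferentiable f t : Prop := cvg (Mquotient f t @ 0^').

(* Only meaningful at points t > 0 where f is M-differentiable. *)
Definition Mderive f : R -> R[i] := fun t => lim (Mquotient f t @ 0^').

Definition Mderiven (k : nat) f : R -> R[i] := iter k Mderive f.

Definition Mdifferentiablen (k : nat) f : Prop :=
  forall i, (i < k)%N -> forall t, 0 < t -> Mdifferentiable (Mderiven i f) t.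

Definition Msolution (n : nat) (p : 'I_n -> R) y : Prop :=
  Mdifferentiablen n y /\
  forall t, 0 < t ->
    Mderiven n y t + \sum_(i < n) (p i)%:C * Mderiven i y t = 0.

(* Functions on (0, +oo) are represented by total functions on R, so equality
   of two of them is agreement at every t > 0; the second clause says that Y
   has n elements in that sense. *)
Definition fundamental_set (n : nat) (p : 'I_n -> R) (Y : set (R -> R[i])) :
    Prop :=
  exists y : 'I_n -> R -> R[i],
    [/\ Y = range y,
        forall i j, (forall t, 0 < t -> y i t = y j t) -> i = j,
        forall i, Msolution p (y i) &
        forall z, Msolution p z ->
          exists c : 'I_n -> R[i],
            forall t, 0 < t -> z t = \sum_(i < n) c i * y i t].

End MDerivative.

Definition char_poly_of (R : realType) (n : nat) (p : 'I_n -> R) :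
    {poly R[i]} :=
  'X^n + \sum_(i < n) (p i)%:C *: 'X^i.

Definition root_of_mult (R : realType) (q : {poly R[i]}) (z : R[i])
    (mu : nat) : Prop :=
  root q z /\ mup z q = mu.

(* Main.v *)
Require Import Defs.
From HB Require Import structures.
From mathcomp Require Import all_boot all_order all_algebra complex.
From mathcomp Require Import all_classical all_reals all_analysis.
From mathcomp Require Import measurable_realfun.
From mathcomp Require Import ring lra.

Set Implicit Arguments.
Unset Strict Implicit.
Unset Printing Implicit Defensive.

Import Order.TTheory GRing.Theory Num.Theory.
Import numFieldNormedType.Exports.

Local Open Scope classical_set_scope.
Local Open Scope ring_scope.
Local Open Scope complex_scope.

(** In the variable x = X(t) = Gamma(beta + 1) / alpha * t ^ alpha the
M-derivative is the ordinary derivative d/dx.  Indeed the quotient samples f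
along the curve eps |-> t E_beta(eps t^-alpha), and E_beta(0) = 1,
E_beta'(0) = 1 / Gamma(beta + 1), so the function X evaluated along this curve
has derivative 1 at eps = 0 ([is_derive_Mtime_Mshift]).  The equation is
therefore a linear equation with constant coefficients in x, and the claim is
the classical one about exponential polynomials P(x) e^(z x).

Analytically, E_beta is differentiable near 0 because Gamma >= e^-2 on
[1, +oo[, which bounds the coefficients of its power series
([is_derive_mittag_leffler]).  M-derivatives then obey the sum and product
rules, and send P(x) e^(z x) to (P' + z P)(x) e^(z x) ([has_Mderive_qpoly]).
The one place where information has to flow from the M-derivative back to the
ordinary one is the fact that a zero M-derivative forces a function to be
constant ([has_Mderive0_cst]): by the intermediate value theorem every point
t + h near t is sampled by some eps of size O(h), so the ordinary derivative
vanishes as well ([Mshift_onto]).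

Let q be the characteristic polynomial, so that the equation reads q(D) y = 0.
If (X - z)^mu divides q and deg P < mu, then q(D) kills P(x) e^(z x), because
D - z acts on it as the differentiation of P ([poly_act_tderiv_eq0]).
Conversely, the assumption on the multiplicities makes q the product of the
X - z with z ranging over the given roots, and [qpoly_span] peels these factors
off one at a time: (D - c) y is an exponential polynomial by induction, a
particular solution is found at the level of polynomials
([first_order_poly_solution]), and the kernel of D - c is spanned by e^(c x)
([has_Mderive_eigen]).  The resulting degree bounds are the multiplicities, so
every solution is a combination of the n functions x^l e^(z x) with
l < mup z q.  These are pairwise different ([qpolyXn_inj]), hence they can be
enumerated without repetition by the n ordinals. *)

(** * The Gamma integral *)

Section Gamma.
Variable R : realType.
Implicit Types x : R.

(** The constant is chosen so that ln u < u at u = s / (2 (x + 1)) yields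
x ln s <= x ln (2 (x + 1)) + s / 2; using x + 1 instead of x keeps the
denominator positive at x = 0. *)
Lemma powR_le_expR_half (x s : R) : 0 <= x -> 0 < s ->
  s `^ x <= expR (x * ln (2 * (x + 1))) * expR (s / 2).
Proof.
move=> x0 s0; rewrite /powR gt_eqF// -expRD ler_expR.
have c0 : 0 < 2 * (x + 1) by rewrite mulr_gt0// ltr_wpDl.
have /ltW sc : ln (s / (2 * (x + 1))) < s / (2 * (x + 1)).
  by apply: ln_sublinear; rewrite divr_gt0.
have -> : ln s = ln (s / (2 * (x + 1))) + ln (2 * (x + 1)).
  by rewrite -lnM ?posrE ?divr_gt0// divfK// gt_eqF.
rewrite mulrDr addrC lerD2l.
apply: (le_trans (ler_wpM2l x0 sc)).
rewrite mulrA ler_pdivrMr//.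
have -> : s / 2 * (2 * (x + 1)) = x * s + s by field.
by rewrite lerDl ltW.
Qed.

Local Notation mu := (@lebesgue_measure R).

(** Half of the decay of exp(- s) absorbs the power, and the other half is
the density of an exponential law up to a constant. *)
Lemma integrable_Gamma x : 1 <= x ->
  mu.-integrable `]0, +oo[ (EFin \o (fun s : R => s `^ (x - 1) * expR (- s))).
Proof.
move=> x1; set C := expR ((x - 1) * ln (2 * (x - 1 + 1))).
have h0 : 0 < 2^-1 :> R by [].
have := integrable_exponential_pdf h0 => /(integrableZl measurableT (2 * C)) ie.
have {}ie : mu.-integrable `]0, +oo[
    (fun s => (2 * C)%:E * (EFin \o exponential_pdf 2^-1) s)%E.
  by apply: integrableS ie.
apply: le_integrable ie => //.
  apply/measurable_EFinP; apply: measurable_funM.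
    by apply: measurable_funTS; exact: measurable_powR.
  by apply: measurable_funTS; apply: measurableT_comp => //;
    exact: measurable_expR.
move=> s /=; rewrite in_itv/= andbT => s0.
rewrite lee_fin exponential_pdfE ?(ltW s0)//.
rewrite !ger0_norm ?mulr_ge0 ?expR_ge0 ?powR_ge0//.
have := @powR_le_expR_half (x - 1) s; rewrite subr_ge0 => /(_ x1 s0) H.
apply: (le_trans (ler_wpM2r (expR_ge0 _) H)).
rewrite -mulrA -expRD (_ : s / 2 - s = - 2^-1 * s); last by field.
by rewrite le_eqVlt; apply/orP; left; apply/eqP; rewrite -/C; field.
Qed.

(** The integrand is at least exp(- 2) on [1, 2].  Integrability is essential
here: a divergent integral would have the real value 0. *)
Lemma Gamma_ge x : 1 <= x -> expR (- 2) <= Gamma x.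
Proof.
move=> x1; have iG := integrable_Gamma x1.
have sub : (`[1%R, 2] : set R) `<=` `]0%R, +oo[.
  by move=> s /=; rewrite !in_itv/= andbT => /andP[+ _]; exact: lt_le_trans.
have iG' : mu.-integrable `[1, 2]
    (EFin \o (fun s : R => s `^ (x - 1) * expR (- s))).
  by apply: integrableS iG.
have mu12 : mu `[1, 2] = 1%E.
  by rewrite lebesgue_measure_itv/= lte_fin ltrDl ltr01 -EFinD; congr EFin; lra.
apply: (@le_trans _ _ (\int[mu]_(s in `[1, 2]) (s `^ (x - 1) * expR (- s)))).
  have -> : expR (- 2) = \int[mu]_(s in `[1%R, 2]) (expR (- 2) : R).
    by rewrite Rintegral_cst// [X in fine X]mu12 mulr1.
  apply: le_Rintegral => //.
    apply/integrableP; split; first exact/measurable_EFinP.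
    rewrite (eq_integral (cst (expR (- 2))%:E)); last first.
      by move=> s _ /=; rewrite ger0_norm ?expR_ge0.
    by rewrite integral_cst// [X in (_ * X)%E]mu12 mule1 ltry.
  move=> s; rewrite /= in_itv/= => /andP[s1 s2].
  rewrite -[leLHS]mul1r ler_pM ?expR_ge0 ?ler_expR ?lerN2//.
by rewrite -[leLHS](powRr0 s) ler_powR// subr_ge0.
rewrite /Gamma /Rintegral fine_le ?integrable_fin_num//.
apply: ge0_subset_integral => //.
  by case/integrableP : iG.
by move=> s _; rewrite lee_fin mulr_ge0 ?powR_ge0 ?expR_ge0.
Qed.

Lemma Gamma_gt0 x : 1 <= x -> 0 < Gamma x.
Proof. by move/Gamma_ge; apply: lt_le_trans; exact: expR_gt0. Qed.

Lemma Gamma1 : Gamma 1 = 1 :> R.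
Proof.
have i1 := integrable_Gamma (lexx 1).
have e s : `[0, +oo[%classic s ->
    (s `^ (1 - 1) * expR (- s) : R) = exponential_pdf 1 s.
  rewrite /= in_itv/= andbT => s0.
  by rewrite exponential_pdfE// subrr powRr0 mulN1r.
rewrite /Gamma Rintegral_itv_obnd_cbnd//.
under eq_Rintegral => s /[!inE] /e ->  do [].
rewrite /Rintegral -[RHS]/(fine 1%E) -(@integral_exponential_pdf R 1 ltr01).
rewrite integral_mkcond; congr fine; apply: eq_integral => s _.
rewrite patchE; case: ifPn => // /negP; rewrite inE /= in_itv/= andbT => /negP.
by rewrite -ltNge => s0; rewrite lt0_exponential_pdf.
Qed.

End Gamma.

(** * The Mittag-Leffler function near the origin *)

Section MittagLeffler.
Variable R : realType.

Lemma cvg_pseries_geometric (c : R^nat) (B rho x : R) : 0 <= B -> 0 <= rho ->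
    (forall n, `|c n| <= B * rho ^+ n) -> rho * `|x| < 1 ->
  cvgn (pseries c x).
Proof.
move=> B0 rho0 cB rx; apply: normed_cvg.
apply: (@series_le_cvg _ _ (geometric B (rho * `|x|))).
- by move=> n; exact: normr_ge0.
- by move=> n; rewrite /= mulr_ge0// exprn_ge0// mulr_ge0.
- move=> n /=; rewrite normrM normrX exprMn mulrA.
  by rewrite ler_wpM2r// exprn_ge0.
- by apply: is_cvg_geometric_series; rewrite ger0_norm// mulr_ge0.
Qed.

(** Differentiating a power series multiplies the coefficients by n + 1, and
n + 1 <= 2 ^ n turns this into a mere doubling of the geometric rate. *)
Lemma pseries_diffs_geometric (c : R^nat) (B rho : R) : 0 <= B -> 0 <= rho ->
    (forall n, `|c n| <= B * rho ^+ n) ->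
  forall n, `|pseries_diffs c n| <= (B * rho) * (2 * rho) ^+ n.
Proof.
move=> B0 rho0 cB n; rewrite /pseries_diffs normrM ger0_norm//.
have -> : B * rho * (2 * rho) ^+ n = 2 ^+ n * (B * rho ^+ n.+1).
  by rewrite exprMn exprS; ring.
by rewrite ler_pM// -natrX ler_nat; exact: ltn_expl.
Qed.

Definition ml_coef (beta : R) (k : nat) : R := (Gamma (beta * k%:R + 1))^-1.

Lemma mittag_lefflerE beta z :
  mittag_leffler beta z = limn (pseries (ml_coef beta) z).
Proof.
rewrite /mittag_leffler /pseries.
by under [in RHS]eq_fun => k do rewrite mulrC.
Qed.

(** The coefficients are bounded by e ^ 2, so those of the second derivative
are O(4 ^ n) and all three series converge at 1/8; any radius below 1/4 would
do. *)
Lemma is_derive_mittag_leffler (beta z : R) : 0 < beta -> `|z| < 8^-1 ->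
  is_derive z 1 (mittag_leffler beta)
    (limn (pseries (pseries_diffs (ml_coef beta)) z)).
Proof.
move=> b0 z8.
have B0 : 0 <= expR 2 :> R by exact: expR_ge0.
have cB0 n : `|ml_coef beta n| <= expR 2 * 1 ^+ n.
  have n1 : 1 <= beta * n%:R + 1 by rewrite lerDr mulr_ge0// ltW.
  rewrite expr1n mulr1 /ml_coef ger0_norm ?invr_ge0 ?(ltW (Gamma_gt0 n1))//.
  rewrite -(invrK (expR 2)) -expRN.
  by rewrite lef_pV2 ?posrE ?expR_gt0 ?Gamma_gt0// Gamma_ge.
have cB1 := pseries_diffs_geometric B0 ler01 cB0.
have B1 : 0 <= expR 2 * 1 :> R by rewrite mulr1.
have r1 : 0 <= 2 * 1 :> R by rewrite mulr1.
have cB2 := pseries_diffs_geometric B1 r1 cB1.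
have -> : mittag_leffler beta = fun z => limn (pseries (ml_coef beta) z).
  by apply/funext => y; exact: mittag_lefflerE.
have K0 : `|8^-1 : R| = 8^-1 by rewrite ger0_norm.
apply: (@pseries_snd_diffs _ _ (8^-1)).
- by apply: cvg_pseries_geometric cB0 _ => //; rewrite K0; lra.
- by apply: cvg_pseries_geometric cB1 _ => //; rewrite K0; lra.
- apply: cvg_pseries_geometric cB2 _ => //; rewrite ?K0; first lra.
- by rewrite K0.
Qed.

Lemma limn_pseries0 (c : R^nat) : limn (pseries c 0) = c 0%N.
Proof.
apply: lim_near_cst => //; exists 1%N => // -[//|n] _ /=.
rewrite /pseries /series /= big_nat_recl//= expr0 mulr1 big1 ?addr0// => i _.
by rewrite exprS mul0r mulr0.
Qed.

Lemma mittag_leffler0 beta : mittag_leffler beta (0 : R) = 1.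
Proof.
by rewrite mittag_lefflerE limn_pseries0 /ml_coef mulr0 add0r Gamma1 invr1.
Qed.

Lemma is_derive_mittag_leffler0 (beta : R) : 0 < beta ->
  is_derive (0 : R) 1 (mittag_leffler beta) (Gamma (beta + 1))^-1.
Proof.
move=> b0; have := @is_derive_mittag_leffler beta 0 b0.
rewrite normr0 limn_pseries0 /pseries_diffs /ml_coef mul1r mulr1; apply.
by rewrite invr_gt0.
Qed.

Lemma continuous_mittag_leffler (beta z : R) : 0 < beta -> `|z| < 8^-1 ->
  {for z, continuous (mittag_leffler beta)}.
Proof.
move=> b0 z8; apply/differentiable_continuous/derivable1_diffP.
by have [] := is_derive_mittag_leffler b0 z8.
Qed.

End MittagLeffler.

(** * Limits of complex-valued functions *)

Section ComplexLimits.
Variables (R : realType) (T : Type) (F : set_system T).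
Context {FF : Filter F}.

Lemma cvg_real_complex (f : T -> R) (l : R) : f @ F --> l ->
  (fun x => (f x)%:C : R[i]^o) @ F --> (l%:C : R[i]^o).
Proof.
move=> fl; apply/cvgrPdist_lt => e e0.
have er : (complex.Re e)%:C = e by apply: RRe_real; exact: gtr0_real.
have e0' : 0 < complex.Re e by rewrite -ltcR er.
move/cvgrPdist_lt : fl => /(_ _ e0'); apply: filterS => x /=.
by rewrite -rmorphB normc_def /= expr0n addr0 sqrtr_sqr -er ltcR.
Qed.

Lemma cvg_Re (f : T -> R[i]^o) (l : R[i]^o) : f @ F --> l ->
  (fun x => complex.Re (f x)) @ F --> complex.Re l.
Proof.
move=> fl; apply/cvgrPdist_lt => e e0.
have e0' : 0 < e%:C by rewrite ltcR.
move/cvgrPdist_lt : fl => /(_ _ e0'); apply: filterS => x /=; rewrite -ltcR.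
apply: le_lt_trans; apply: le_trans (normc_ge_Re _).
by rewrite lecR raddfB.
Qed.

(** Multiplication by - 'i carries the imaginary part to the real part. *)
Lemma cvg_Im (f : T -> R[i]^o) (l : R[i]^o) : f @ F --> l ->
  (fun x => complex.Im (f x)) @ F --> complex.Im l.
Proof.
move=> fl; have h := cvgM (cvg_cst (- 'i%C : R[i]^o)) fl.
have {}h := cvg_Re (h FF FF).
suff e z : complex.Re (- 'i%C * z) = complex.Im z :> R.
  move: h; rewrite e; apply: cvg_trans; apply: near_eq_cvg.
  by apply: nearW => x; exact: e.
by rewrite mulNr raddfN /= mulrC ReiNIm opprK.
Qed.

End ComplexLimits.

(** * Differentiation rules *)

Section MCalculus.
Variables (R : realType) (alpha beta : R).
Hypotheses (alpha_gt0 : 0 < alpha) (beta_gt0 : 0 < beta).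
Implicit Types (f g : R -> R[i]) (t : R).

(** The point at which the difference quotient evaluates the function. *)
Definition Mshift t (e : R) : R := t * mittag_leffler beta (e * t `^ (- alpha)).

(** Carrying the value of the limit makes the differentiation rules
composable, which [lim] is not. *)
Definition has_Mderive f t (l : R[i]) : Prop :=
  Mquotient alpha beta f t @ 0^' --> (l : R[i]^o).

Lemma has_MderiveE f t l : has_Mderive f t l ->
  Mdifferentiable alpha beta f t /\ Mderive alpha beta f t = l.
Proof.
move=> fl; split; first by apply/cvg_ex; exists l.
by apply: cvg_lim fl; exact: norm_hausdorff.
Qed.

Lemma Mshift0 t : Mshift t 0 = t.
Proof. by rewrite /Mshift mul0r mittag_leffler0 mulr1. Qed.

(** The derivative at 0 of [Mshift t]. *)
Definition Mspeed t : R := t * t `^ (- alpha) / Gamma (beta + 1).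

Lemma Gamma_beta_gt0 : 0 < Gamma (beta + 1).
Proof. by apply: Gamma_gt0; rewrite lerDr ltW. Qed.

Lemma Mspeed_gt0 t : 0 < t -> 0 < Mspeed t.
Proof. by move=> t0; rewrite !mulr_gt0 ?invr_gt0 ?powR_gt0 ?Gamma_beta_gt0. Qed.

Lemma is_derive_Mshift0 t : is_derive (0 : R) 1 (Mshift t) (Mspeed t).
Proof.
have := is_derive_mittag_leffler0 beta_gt0.
rewrite -{1}(mul0r (t `^ (- alpha))) => dE.
rewrite /Mshift; apply: is_derive_eq.
by rewrite /GRing.scale /= /Mspeed; ring.
Qed.

Lemma continuous_Mshift t e : 0 < t -> `|e| * t `^ (- alpha) < 8^-1 ->
  {for e, continuous (Mshift t)}.
Proof.
move=> t0 he; apply: cvgM; first exact: cvg_cst.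
have : {for e, continuous (mittag_leffler beta \o (fun e => e * t `^ (- alpha)))}.
  apply: (@continuous_comp R R R); last first.
    apply: continuous_mittag_leffler => //.
    by rewrite normrM (ger0_norm (powR_ge0 _ _)).
  by apply: cvgM; [exact: cvg_id|exact: cvg_cst].
by [].
Qed.

Lemma cvg_Mshift t : 0 < t -> Mshift t e @[e --> 0] --> t.
Proof.
move=> t0; rewrite -{2}(Mshift0 t); apply: continuous_Mshift => //.
by rewrite normr0 mul0r invr_gt0.
Qed.

Lemma near_Mshift_gt0 t : 0 < t -> \forall e \near 0^', 0 < Mshift t e.
Proof.
move=> t0; apply: nbhs_dnbhs; exact: (cvgr_gt t (cvg_Mshift t0)).
Qed.

(** Only values on ]0, +oo[ enter the limit, since the sampling points stay
positive for small eps. *)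
Lemma eq_has_Mderive f g t l : (forall s, 0 < s -> f s = g s) -> 0 < t ->
  has_Mderive f t l -> has_Mderive g t l.
Proof.
move=> fg t0; apply: cvg_trans; apply: near_eq_cvg.
near=> e; rewrite /Mquotient !fg//.
by rewrite -/(Mshift t e); near: e; exact: near_Mshift_gt0.
Unshelve. all: by end_near. Qed.

Lemma has_Mderive_cst c t : has_Mderive (fun=> c) t 0.
Proof.
apply: cvg_near_cst; near=> e; by rewrite /Mquotient subrr mul0r.
Unshelve. all: by end_near. Qed.

Lemma has_MderiveD f g t l k : has_Mderive f t l -> has_Mderive g t k ->
  has_Mderive (fun s => f s + g s) t (l + k).
Proof.
move=> fl gk; apply: cvg_trans (cvgD fl gk).
apply: near_eq_cvg; near=> e; rewrite /Mquotient -mulrDl; congr (_ / _).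
by rewrite /GRing.add/= opprD addrACA.
Unshelve. all: by end_near. Qed.

Lemma has_MderiveM f g t l k : has_Mderive f t l -> has_Mderive g t k ->
  has_Mderive (fun s => f s * g s) t (l * g t + f t * k).
Proof.
move=> fl gk.
have e0 : (fun e : R => e%:C : R[i]^o) @ 0^' --> ((0 : R)%:C : R[i]^o).
  by apply: cvg_real_complex; apply: cvg_within_filter; exact: cvg_id.
(* Existence of the limit gives continuity along the sampling curve. *)
have gt' : g (Mshift t e) @[e --> 0^'] --> (g t : R[i]^o).
  have h : (fun e : R =>
      (g t : R[i]^o) + (e%:C : R[i]^o) * Mquotient alpha beta g t e)
      @ 0^' --> (g t : R[i]^o) + (0%:C : R[i]^o) * (k : R[i]^o).
    by apply: cvgD; [exact: cvg_cst|exact: (cvgM e0 gk)].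
  move: h.
  rewrite mul0r addr0; apply: cvg_trans; apply: near_eq_cvg.
  near=> e; rewrite /Mquotient /= -/(Mshift t e).
  have en0 : e%:C != 0 :> R[i].
    by rewrite fmorph_eq0; near: e; exact: nbhs_dnbhs_neq.
  by rewrite mulrCA mulfV// mulr1 addrC subrK.
apply: cvg_trans (cvgD (cvgM fl gt') (cvgM (cvg_cst (f t : R[i]^o)) gk)).
have split_quotient (a b c d h : R[i]) :
    (a - b) / h * c + b * ((c - d) / h) = (a * c - b * d) / h by ring.
apply: near_eq_cvg; near=> e; exact: split_quotient.
Unshelve. all: by end_near. Qed.

Lemma has_MderiveZ c f t l : has_Mderive f t l ->
  has_Mderive (fun s => c * f s) t (c * l).
Proof.
by move=> fl; have := has_MderiveM (has_Mderive_cst c t) fl; rewrite mul0r add0r.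
Qed.

Lemma has_MderiveB f g t l k : has_Mderive f t l -> has_Mderive g t k ->
  has_Mderive (fun s => f s - g s) t (l - k).
Proof.
move=> fl gk; have := has_MderiveD fl (@has_MderiveZ (-1) _ _ _ gk).
by rewrite mulN1r; under eq_fun do rewrite mulN1r.
Qed.

Lemma has_Mderive_sum (I : Type) (r : seq I) (f : I -> R -> R[i]) t
    (l : I -> R[i]) :
    (forall i, has_Mderive (f i) t (l i)) ->
  has_Mderive (fun s => \sum_(i <- r) f i s) t (\sum_(i <- r) l i).
Proof.
move=> fl; elim: r => [|i r IH].
  rewrite big_nil (_ : (fun _ => _) = fun=> 0); first exact: has_Mderive_cst.
  by apply/funext => s; rewrite big_nil.
rewrite big_cons; have := has_MderiveD (fl i) IH; congr (has_Mderive _ _ _).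
by apply/funext => s; rewrite big_cons.
Qed.

(** The variable in which the M-derivative is the ordinary derivative. *)
Definition Mtime t : R := Gamma (beta + 1) / alpha * t `^ alpha.

Lemma Mtime_gt0 t : 0 < t -> 0 < Mtime t.
Proof. by move=> t0; rewrite !mulr_gt0 ?invr_gt0 ?powR_gt0 ?Gamma_beta_gt0. Qed.

(** X'(t) is Gamma(beta + 1) t^(alpha - 1) and the sampling curve has speed
t^(1 - alpha) / Gamma(beta + 1), so the two factors cancel. *)
Lemma is_derive_Mtime_Mshift t : 0 < t ->
  is_derive (0 : R) 1 (Mtime \o Mshift t) 1.
Proof.
move=> t0.
have dX : is_derive (Mshift t 0) 1 Mtime
    (Gamma (beta + 1) / alpha * (alpha * t `^ (alpha - 1))).
  rewrite Mshift0 /Mtime; have := is_derive1_powR alpha t0 => ?.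
  by apply: is_derive_eq.
have dS := is_derive_Mshift0 t.
apply: (is_derive_eq (is_derive1_comp dX dS)).
rewrite /Mspeed powRN -(mulr_powRB1 (ltW t0) alpha_gt0).
have := Gamma_beta_gt0; have := powR_gt0 (alpha - 1) t0.
by move=> /gt_eqF p0 /gt_eqF G0; field; rewrite p0 G0 !gt_eqF.
Qed.

Lemma has_Mderive_real (phi : R -> R) (d t : R) : 0 < t ->
    is_derive (Mtime t) 1 phi d ->
  has_Mderive (fun s => (phi (Mtime s))%:C) t d%:C.
Proof.
move=> t0; rewrite -{1}(Mshift0 t) => dphi.
have dX := is_derive_Mtime_Mshift t0.
have [dc dv] := @is_derive1_comp R phi (Mtime \o Mshift t) 0 _ _ dphi dX.
have : h^-1 *: (phi (Mtime (Mshift t h)) - phi (Mtime t)) @[h --> 0^'] --> d.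
  rewrite mulr1 in dv.
  have : h^-1 *: (((phi \o (Mtime \o Mshift t)) \o shift 0) (h *: 1) -
      (phi \o (Mtime \o Mshift t)) 0) @[h --> 0^'] -->
      'D_1 (phi \o (Mtime \o Mshift t)) 0.
    exact: dc.
  rewrite dv; apply: cvg_trans; apply: near_eq_cvg; near=> h; rewrite /=.
  by rewrite addr0 [h%:A]mulr1 Mshift0.
move=> /cvg_real_complex; rewrite /has_Mderive; apply: cvg_trans.
apply: near_eq_cvg; near=> h.
by rewrite /Mquotient -/(Mshift t h) -rmorphB -fmorphV -rmorphM /= mulrC.
Unshelve. all: by end_near. Qed.

Lemma cexpE (z : R[i]) (x : R) : cexp (z * x%:C) =
  (expR (complex.Re z * x))%:C *
  ((cos (complex.Im z * x))%:C + 'i%C * (sin (complex.Im z * x))%:C).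
Proof.
case: z => a b; rewrite /cexp/=; congr (_ * _);
  by rewrite ?mulr0 ?subr0 ?add0r//; simpc.
Qed.

Lemma cexp_neq0 (z : R[i]) : cexp z != 0.
Proof.
apply: mulf_neq0; first by rewrite fmorph_eq0 gt_eqF ?expR_gt0.
apply/eqP => -[c0 s0].
have := cos2Dsin2 (complex.Im z); rewrite c0 s0 expr0n addr0 => /eqP.
by rewrite eq_sym oner_eq0.
Qed.

(** The complex exponential splits into real functions of X(t), to which
[has_Mderive_real] applies; the rest is 'i ^ 2 = - 1. *)
Lemma has_Mderive_cexp (z : R[i]) t : 0 < t ->
  has_Mderive (fun s => cexp (z * (Mtime s)%:C)) t (z * cexp (z * (Mtime t)%:C)).
Proof.
move=> t0; under eq_fun do rewrite cexpE; rewrite cexpE.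
have hE : has_Mderive (fun s => (expR (complex.Re z * Mtime s))%:C) t
    (complex.Re z * expR (complex.Re z * Mtime t))%:C.
  apply: (@has_Mderive_real (fun x => expR (complex.Re z * x))) => //.
  by apply: is_derive_eq; rewrite /GRing.scale/=; ring.
have hC : has_Mderive (fun s => (cos (complex.Im z * Mtime s))%:C) t
    (- complex.Im z * sin (complex.Im z * Mtime t))%:C.
  apply: (@has_Mderive_real (fun x => cos (complex.Im z * x))) => //.
  by apply: is_derive_eq; rewrite /GRing.scale/=; ring.
have hS : has_Mderive (fun s => (sin (complex.Im z * Mtime s))%:C) t
    (complex.Im z * cos (complex.Im z * Mtime t))%:C.
  apply: (@has_Mderive_real (fun x => sin (complex.Im z * x))) => //.
  by apply: is_derive_eq; rewrite /GRing.scale/=; ring.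
have := has_MderiveM hE (has_MderiveD hC (@has_MderiveZ 'i%C _ _ _ hS)).
congr has_Mderive.
rewrite [X in _ = X * _](complexE z) !rmorphM rmorphN /=.
have i2 := sqr_i R.
by ring: i2.
Qed.

Definition qpoly (P : {poly R[i]}) (z : R[i]) t : R[i] :=
  P.[(Mtime t)%:C] * cexp (z * (Mtime t)%:C).

Lemma has_Mderive_horner (P : {poly R[i]}) t : 0 < t ->
  has_Mderive (fun s => P.[(Mtime s)%:C]) t P^`().[(Mtime t)%:C].
Proof.
move=> t0; have hX : has_Mderive (fun s => (Mtime s)%:C) t 1.
  by apply: (@has_Mderive_real (fun x => x)) => //; exact: is_derive_id.
elim/poly_ind: P => [|P c IH].
  rewrite deriv0 horner0; under eq_fun do rewrite horner0.
  exact: has_Mderive_cst.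
rewrite derivMXaddC hornerD hornerMX.
under eq_fun do rewrite hornerMXaddC.
have := has_MderiveD (has_MderiveM IH hX) (has_Mderive_cst c t).
by rewrite mulr1 addr0 addrC.
Qed.

Lemma has_Mderive_qpoly P z t : 0 < t ->
  has_Mderive (qpoly P z) t (qpoly (P^`() + z *: P) z t).
Proof.
move=> t0; rewrite /qpoly.
have := has_MderiveM (@has_Mderive_horner P t t0) (@has_Mderive_cexp z t t0).
by congr has_Mderive; rewrite hornerD hornerZ; ring.
Qed.

End MCalculus.

(** * Functions with zero M-derivative *)

Section ZeroDerivative.
Variables (R : realType) (alpha beta : R).
Hypothesis beta_gt0 : 0 < beta.
Local Notation Mshift := (Mshift alpha beta).

(** The curve eps |-> Mshift t eps starts at t with positive speed c, so for
small eta it passes from below t - c eta / 2 to above t + c eta / 2 when eps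
runs through [- eta, eta]; the intermediate value theorem then reaches every
t + h with |h| < c eta / 2, and the same slope estimate gives |eps| <= 2 |h| / c. *)
Lemma Mshift_onto t : 0 < t -> exists2 K : R, 0 < K & forall d, 0 < d ->
  \forall h \near 0,
    exists e, [/\ `|e| < d, Mshift t e = t + h & `|e| <= K * `|h|].
Proof.
move=> t0; have c0 := Mspeed_gt0 alpha beta_gt0 t0; set c := Mspeed _ _ _ in c0.
have [dc dv] := is_derive_Mshift0 alpha beta_gt0 t.
have : h^-1 *: ((Mshift t \o shift 0) (h *: 1) - Mshift t 0) @[h --> 0^'] -->
    'D_1 (Mshift t) 0.
  exact: dc.
rewrite dv => /cvgrPdist_le/(_ (c / 2)); rewrite divr_gt0// => /(_ isT).
move=> [d0 /= d00 Hd0].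
have slope e : `|e| < d0 -> `|c * e - (Mshift t e - t)| <= c / 2 * `|e|.
  move=> ed0; have [->|en0] := eqVneq e 0.
    by rewrite mulr0 Mshift0 subrr subr0 normr0 mulr0.
  have := Hd0 e; rewrite /= sub0r normrN => /(_ ed0 en0).
  rewrite /= addr0 Mshift0 [e%:A]mulr1 -/c => He.
  rewrite -ler_pdivrMr ?normr_gt0// -normfV -normrM.
  by rewrite mulrBl mulfK// [X in c - X]mulrC.
have p0 : 0 < t `^ (- alpha) by rewrite powR_gt0.
pose d1 := 8^-1 / t `^ (- alpha).
have d10 : 0 < d1 by rewrite divr_gt0.
exists (2 / c); first by rewrite divr_gt0.
move=> d dpos; pose eta := Num.min d (Num.min d0 d1) / 2.
have m0 : 0 < Num.min d (Num.min d0 d1) by rewrite !lt_min dpos d00 d10.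
have eta0 : 0 < eta by rewrite divr_gt0.
have : eta < Num.min d (Num.min d0 d1) by rewrite ltr_pdivrMr// ltr_pMr// ltrDl.
rewrite !lt_min => /and3P[etad etad0 etad1].
have ch0 : 0 < c / 2 * eta by rewrite mulr_gt0// divr_gt0.
near=> h.
have hh : `|h| < c / 2 * eta by near: h; apply: (@nbhs0_lt _ R).
move: (hh); rewrite ltr_norml => /andP[h1 h2].
have := slope eta; rewrite (gtr0_norm eta0) => /(_ etad0).
rewrite ler_norml => /andP[_ s1].
have := slope (- eta); rewrite normrN (gtr0_norm eta0) => /(_ etad0).
rewrite ler_norml => /andP[s2 _].
have le1 : Mshift t (- eta) <= t + h by lra.
have le2 : t + h <= Mshift t eta by lra.
have [e] : exists2 e, e \in `[- eta, eta] & Mshift t e = t + h.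
  apply: IVT.
  - by rewrite ge0_cp// ltW.
  - apply: continuous_in_subspaceT => e; rewrite inE /= in_itv/= => ee.
    apply: continuous_Mshift => //; rewrite -ltr_pdivlMr//.
    by apply: le_lt_trans etad1; rewrite ler_norml.
  - by rewrite ge_min le1/= le_max le2 orbT.
rewrite in_itv/= -ler_norml => ee Ee; exists e; split => //.
  exact: le_lt_trans etad.
have := slope e (le_lt_trans ee etad0); rewrite Ee addrAC subrr add0r => se.
rewrite mulrAC ler_pdivlMr//.
have : `|c * e| <= `|c * e - h| + `|h|.
  by rewrite (le_trans _ (ler_normD _ _))// subrK.
rewrite normrM (gtr0_norm c0) => H.
by lra.
Unshelve. all: by end_near. Qed.

(** Writing t + h as a sampling point with |eps| <= K |h| bounds the ordinary
difference quotient at h by K times the given quotient at eps, so g has zero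
derivative and the mean value theorem concludes. *)
Lemma Mshift_derive0_cst (g : R -> R) :
    (forall t : R, 0 < t -> (g (Mshift t e) - g t) / e @[e --> 0^'] --> 0) ->
  forall s t, 0 < s -> 0 < t -> g s = g t.
Proof.
move=> g0.
have dg (t : R) : 0 < t -> is_derive t 1 g 0.
  move=> t0; have [K K0 HK] := Mshift_onto t0.
  suff h0 : h^-1 *: ((g \o shift t) (h *: 1) - g t) @[h --> 0^'] --> 0.
    split; first by apply/cvg_ex; exists 0.
    exact: cvg_lim h0.
  apply/cvgrPdist_lt => x x0.
  have /cvgrPdist_lt/(_ (x / K)) := g0 _ t0.
  rewrite divr_gt0// => /(_ isT)[d /= d0 Hd].
  near=> h.
  have hn0 : h != 0 by near: h; exact: nbhs_dnbhs_neq.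
  have [e [ed Ee eK]] :
      exists e, [/\ `|e| < d, Mshift t e = t + h & `|e| <= K * `|h|].
    by near: h; apply: nbhs_dnbhs; exact: HK.
  have en0 : e != 0.
    apply/eqP => e0; move: Ee; rewrite e0 Mshift0 => /eqP.
    by rewrite -subr_eq0 opprD addNKr oppr_eq0 (negPf hn0).
  have := Hd e; rewrite /= sub0r normrN => /(_ ed en0).
  rewrite Ee sub0r normrN normrM normfV ltr_pdivrMr ?normr_gt0// => H.
  rewrite sub0r normrN [h%:A]mulr1 /= [_ *: _]mulrC normrM normfV.
  rewrite ltr_pdivrMr ?normr_gt0// [h + t]addrC.
  apply: (lt_le_trans H); rewrite mulrAC ler_pdivrMr// -mulrA ler_pM2l//.
  by rewrite mulrC.
have gc (x : R) : 0 < x -> {for x, continuous g}.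
  move=> x0; apply/differentiable_continuous/derivable1_diffP.
  by have [] := dg _ x0.
have lt_cst (s t : R) : 0 < s -> s < t -> g s = g t.
  move=> s0 st.
  have [||c _] := @MVT R g (fun=> 0) s t st.
  - by move=> x; rewrite in_itv/= => /andP[sx _]; apply: dg; exact: lt_trans sx.
  - apply: continuous_in_subspaceT => x; rewrite inE/= in_itv/= => /andP[sx _].
    by apply: gc; exact: lt_le_trans sx.
  by rewrite mul0r => /eqP; rewrite subr_eq0 => /eqP.
move=> s t s0 t0; have [st|ts|->//] := ltgtP s t; first exact: lt_cst.
by apply/esym; exact: lt_cst.
Unshelve. all: by end_near. Qed.

Lemma has_Mderive0_cst (f : R -> R[i]) :
    (forall t, 0 < t -> has_Mderive alpha beta f t 0) ->
  forall s t, 0 < s -> 0 < t -> f s = f t.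
Proof.
move=> f0 s t s0 t0; apply/eqP; rewrite eq_complex; apply/andP.
split; apply/eqP.
  apply: (@Mshift_derive0_cst (fun t => complex.Re (f t))) => // x x0.
  have /cvg_Re := f0 x x0; apply: cvg_trans; apply: near_eq_cvg; near=> e.
  rewrite /Mquotient -fmorphV mulrC.
  by case: (f _) (f x) => [a b] [c d]; rewrite /= mul0r subr0 mulrC.
apply: (@Mshift_derive0_cst (fun t => complex.Im (f t))) => // x x0.
have /cvg_Im := f0 x x0; apply: cvg_trans; apply: near_eq_cvg; near=> e.
rewrite /Mquotient -fmorphV mulrC.
by case: (f _) (f x) => [a b] [c d]; rewrite /= mul0r addr0 mulrC.
Unshelve. all: by end_near. Qed.

End ZeroDerivative.

(** * Polynomials in a differentiation operator *)

Section PolynomialAction.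
Variables (K : comNzRingType) (V : lmodType K).
Implicit Types (q : {poly K}) (F : nat -> V).

(** With F the sequence of successive derivatives of f, this is q(D) f.
Taking the sequence as argument avoids asking that D be a total linear
operator, and covers both functions at a point and polynomials. *)
Definition poly_act q F : V := \sum_(i < size q) q`_i *: F i.

Lemma poly_act_widen q F N : (size q <= N)%N ->
  poly_act q F = \sum_(i < N) q`_i *: F i.
Proof.
move=> qN; rewrite /poly_act (big_ord_widen _ (fun i => q`_i *: F i) qN).
rewrite big_mkcond.
by apply: eq_bigr => i _; case: ltnP => // /(nth_default 0) ->; rewrite scale0r.
Qed.

Lemma poly_act1 F : poly_act 1 F = F 0%N.
Proof. by rewrite /poly_act size_poly1 big_ord1 coef1 scale1r. Qed.

Lemma eq_poly_act q F G : F =1 G -> poly_act q F = poly_act q G.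
Proof. by move=> FG; apply: eq_bigr => i _; rewrite FG. Qed.

Lemma poly_act0 q : poly_act q (fun=> 0) = 0.
Proof. by apply: big1 => i _; rewrite scaler0. Qed.

(** In operator terms (q (X - c))(D) = q(D) (D - c), where D is the shift of
the sequence. *)
Lemma poly_act_mulXsubC q c F :
  poly_act (q * ('X - c%:P)) F = poly_act q (fun i => F i.+1 - c *: F i).
Proof.
rewrite (@poly_act_widen _ _ (size q).+1); last first.
  by rewrite (leq_trans (size_polyMleq _ _))// size_XsubC addn2.
under eq_bigr do rewrite mulrBr coefB coefMX coefMC scalerBl.
rewrite sumrB big_ord_recl/= scale0r add0r.
rewrite [X in _ - X]big_ord_recr/= [q`_(size q)]nth_default// mul0r scale0r addr0.
rewrite -sumrB; apply: eq_bigr => i _.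
by rewrite scalerBr scalerA.
Qed.

End PolynomialAction.

Section ShiftedDerivation.
Variable K : comNzRingType.
Implicit Types (P q : {poly K}) (z : K).

(** Conjugating d/dx by e^(z x): the derivative of P(x) e^(z x) is
[(tderiv z P)(x) e^(z x)]. *)
Definition tderiv z P : {poly K} := P^`() + z *: P.

Lemma iter_tderiv0 z i : iter i (tderiv z) 0 = 0.
Proof. by elim: i => //= i ->; rewrite /tderiv deriv0 scaler0 addr0. Qed.

Lemma deriv_iter_tderiv z i P :
  (iter i (tderiv z) P)^`() = iter i (tderiv z) P^`().
Proof. by elim: i => //= i IH; rewrite /tderiv derivD derivZ IH. Qed.

(** [tderiv z] minus z is the ordinary derivative, which commutes with
[tderiv z]; each factor X - z thus lowers the size of P, and mu of them
annihilate it. *)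
Lemma poly_act_tderiv_eq0 z mu q P : (size P <= mu)%N ->
  poly_act (q * ('X - z%:P) ^+ mu) (fun i => iter i (tderiv z) P) = 0.
Proof.
elim: mu P => [|mu IH] P.
  rewrite leqn0 size_poly_eq0 => /eqP ->.
  by under eq_poly_act do rewrite iter_tderiv0; rewrite poly_act0.
move=> Pmu; rewrite exprSr mulrA poly_act_mulXsubC.
rewrite (@eq_poly_act _ _ _ _ (fun i => iter i (tderiv z) P^`())) ?IH//.
  have [->|P0] := eqVneq P 0; first by rewrite deriv0 size_poly0.
  by rewrite -ltnS (leq_trans (lt_size_deriv P0)).
by move=> i; rewrite iterS {1}/tderiv addrK deriv_iter_tderiv.
Qed.

End ShiftedDerivation.

(** * First-order equations between polynomials *)

Section SolveFirstOrder.
Variable K : numFieldType.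
Implicit Types (P Q : {poly K}) (d : K).

Lemma antiderivP P : exists2 Q, Q^`() = P & (size Q <= (size P).+1)%N.
Proof.
exists (\poly_(i < (size P).+1) (P`_i.-1 / i%:R)); last exact: size_poly.
apply/polyP => i; rewrite coef_deriv coef_poly ltnS /=.
case: ltnP => [_|Pi]; last by rewrite mul0rn nth_default.
by rewrite -[LHS]mulr_natr divfK// pnatr_eq0.
Qed.

(** Q = P / d is a solution up to the error P' / d, which has smaller size and
is corrected by induction. *)
Lemma tderiv_onto d P : d != 0 ->
  exists2 Q, Q^`() + d *: Q = P & (size Q <= size P)%N.
Proof.
move=> d0; have [N] := ubnP (size P); elim: N P => // N IH P.
rewrite ltnS => PN.
have [->|P0] := eqVneq P 0; first by exists 0; rewrite ?deriv0 ?scaler0 ?addr0.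
have sP' : (size (- (d^-1 *: P)^`()) < size P)%N.
  rewrite size_polyN derivZ.
  by rewrite (leq_ltn_trans (size_scale_leq _ _))// lt_size_deriv.
have [Q eQ sQ] := IH _ (leq_trans sP' PN).
exists (d^-1 *: P + Q).
  rewrite derivD scalerDr scalerA divff// scale1r addrACA eQ.
  by rewrite addrAC subrr add0r.
rewrite (leq_trans (size_polyD _ _))// geq_max size_scale_leq/=.
exact: leq_trans sQ (ltnW sP').
Qed.

(** The size grows only in the resonant case d = 0, where one integrates; this
is the source of the powers of x attached to multiple roots. *)
Lemma first_order_poly_solution d P :
  exists2 Q, Q^`() + d *: Q = P & (size Q <= size P + (d == 0%R))%N.
Proof.
have [->|d0] := eqVneq d 0.
  have [Q <- sQ] := antiderivP P; exists Q; first by rewrite scale0r addr0.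
  by rewrite addn1.
by rewrite addn0; exact: tderiv_onto.
Qed.

End SolveFirstOrder.

(** * Counting roots *)

Section RootCounting.
Variable K : fieldType.

Lemma mup_prod_XsubC (s : seq K) c :
  mup c (\prod_(z <- s) ('X - z%:P)) = count_mem c s.
Proof.
elim: s => [|z s IH]; first by rewrite big_nil mupNroot// root1.
rewrite big_cons mupM ?polyXsubC_eq0//; last first.
  by rewrite monic_neq0 ?monic_prod_XsubC.
by rewrite IH -['X - z%:P]expr1 mup_XsubCX /=; case: eqP.
Qed.

End RootCounting.

Lemma sum_count_mem (T : eqType) (s t : seq T) : uniq t ->
  (\sum_(x <- t) count_mem x s = count [in t] s)%N.
Proof.
elim: t => [|x t IH] /=; first by rewrite big_nil count_pred0.
move=> /andP[xt ut]; rewrite big_cons IH// -count_predUI.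
rewrite [X in (_ + X)%N](_ : _ = 0%N).
  by rewrite addn0; apply: eq_count => y /=; rewrite inE.
apply/eqP; rewrite -leqn0 leqNgt -has_count; apply/hasPn => y _ /=.
by rewrite negb_and; have [->|//] := eqVneq y x; rewrite xt.
Qed.

(** * Exponential polynomials *)

Section QuasiPolynomials.
Variables (R : realType) (alpha beta : R).
Hypotheses (alpha_gt0 : 0 < alpha) (beta_gt0 : 0 < beta).
Local Notation C := R[i].
Local Notation qpoly := (qpoly alpha beta).
Local Notation Mtime := (Mtime alpha beta).
Local Notation has_Mderive := (has_Mderive alpha beta).

Lemma qpolyD P Q z t : qpoly (P + Q) z t = qpoly P z t + qpoly Q z t.
Proof. by rewrite /qpoly hornerD mulrDl. Qed.

Lemma qpolyZ c P z t : qpoly (c *: P) z t = c * qpoly P z t.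
Proof. by rewrite /qpoly hornerZ mulrA. Qed.

(** The exponential factor is common to all terms, so q acts on P alone. *)
Lemma poly_act_qpoly q (F : nat -> {poly C}) z t :
  poly_act (V := C^o) q (fun i => qpoly (F i) z t) = qpoly (poly_act q F) z t.
Proof.
rewrite /qpoly /poly_act horner_sum mulr_suml; apply: eq_bigr => i _.
by rewrite hornerZ -[RHS]mulrA.
Qed.

(** Iterated derivatives only agree with the F i on ]0, +oo[, so each step
goes through the locality of the M-derivative. *)
Lemma Mderiven_chain (F : nat -> R -> C) :
    (forall i t, 0 < t -> has_Mderive (F i) t (F i.+1 t)) ->
  forall i, (forall t, 0 < t -> Mderiven alpha beta i (F 0%N) t = F i t) /\
    (forall t, 0 < t ->
      Mdifferentiable alpha beta (Mderiven alpha beta i (F 0%N)) t).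
Proof.
move=> dF i.
have eF : forall t, 0 < t -> Mderiven alpha beta i (F 0%N) t = F i t.
  elim: i => [//|i IH] t t0 /=.
  apply: (has_MderiveE _).2.
  apply: (@eq_has_Mderive _ _ _ beta_gt0 (F i)) => //; last exact: dF.
  by move=> s s0; rewrite -IH.
split=> // t t0.
have H : has_Mderive (Mderiven alpha beta i (F 0%N)) t (F i.+1 t).
  apply: (@eq_has_Mderive _ _ _ beta_gt0 (F i)) => //; last exact: dF.
  by move=> s s0; rewrite eF.
exact: (has_MderiveE H).1.
Qed.

Lemma Mderiven_qpoly P z i :
  (forall t, 0 < t -> Mderiven alpha beta i (qpoly P z) t =
    qpoly (iter i (tderiv z) P) z t) /\
  (forall t, 0 < t ->
    Mdifferentiable alpha beta (Mderiven alpha beta i (qpoly P z)) t).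
Proof.
apply: (@Mderiven_chain (fun i => qpoly (iter i (tderiv z) P) z)) => {}i t t0 /=.
exact: has_Mderive_qpoly.
Qed.

Lemma cexpD (x y : C) : cexp (x + y) = cexp x * cexp y.
Proof.
case: x y => [a b] [c d]; rewrite /cexp /= expRD cosD sinD; simpc.
by congr Complex; ring.
Qed.

Lemma cexp0 : cexp 0 = 1 :> C.
Proof. by rewrite /cexp/= expR0 cos0 sin0; simpc. Qed.

(** The product of f with e^(- c x) has zero M-derivative. *)
Lemma has_Mderive_eigen (c : C) (f : R -> C) :
    (forall t, 0 < t -> has_Mderive f t (c * f t)) ->
  exists k, forall t, 0 < t -> f t = k * cexp (c * (Mtime t)%:C).
Proof.
move=> df; pose g t := f t * cexp (- c * (Mtime t)%:C).
exists (g 1) => t t0.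
have <- : g t = g 1.
  apply: (has_Mderive0_cst beta_gt0 _ t0 ltr01) => s s0.
  have := has_MderiveM (df s s0)
    (@has_Mderive_cexp _ _ _ alpha_gt0 beta_gt0 (- c) s s0).
  by congr has_Mderive; ring.
by rewrite /g -mulrA -cexpD -mulrDl addNr mul0r cexp0 mulr1.
Qed.

(** Variation of constants, one root at a time.  The functions F i stand for
the successive derivatives of a solution; replacing F i by F (i + 1) - c F i
removes the factor X - c.  The sum runs over a fixed list T, larger than s, so
that it does not change its shape during the induction. *)
Lemma qpoly_span (T : seq C) : uniq T -> forall (s : seq C) (F : nat -> R -> C),
    {subset s <= T} ->
    (forall i t, (i < size s)%N -> 0 < t -> has_Mderive (F i) t (F i.+1 t)) ->
    (forall t, 0 < t ->
      poly_act (V := C^o) (\prod_(z <- s) ('X - z%:P)) (fun i => F i t) = 0) ->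
  exists2 P : C -> {poly C}, forall z, (size (P z) <= count_mem z s)%N &
    forall t, 0 < t -> F 0%N t = \sum_(z <- T) qpoly (P z) z t.
Proof.
move=> uT; elim=> [|c s IH] F sT dF actF.
  exists (fun=> 0) => [z|t t0]; first by rewrite size_poly0.
  rewrite big1 => [|z _]; last by rewrite /qpoly horner0 mul0r.
  by have := actF t t0; rewrite big_nil poly_act1.
have [|i t si t0|t t0|P sP eP] := IH (fun i t => F i.+1 t - c * F i t).
- by move=> z zs; apply: sT; rewrite inE zs orbT.
- apply: has_MderiveB; first exact: dF.
  by apply: has_MderiveZ; apply: dF => //; rewrite /= ltnW.
- by have := actF t t0; rewrite big_cons mulrC poly_act_mulXsubC.
have /choice[Q HQ] : forall z, exists Q, Q^`() + (z - c) *: Q = P z /\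
    (size Q <= size (P z) + (z == c))%N.
  move=> z; have [Q eQ sQ] := first_order_poly_solution (z - c) (P z).
  by exists Q; rewrite -subr_eq0.
(* f is the part of the solution left in the kernel of D - c. *)
pose f t := F 0%N t - \sum_(z <- T) qpoly (Q z) z t.
have [k fk] : exists k, forall t, 0 < t -> f t = k * cexp (c * (Mtime t)%:C).
  apply: has_Mderive_eigen => t t0.
  have -> : c * f t = F 1%N t - \sum_(z <- T) qpoly (tderiv z (Q z)) z t.
    rewrite /f mulrBr; have -> : F 1%N t = c * F 0%N t + (F 1%N t - c * F 0%N t).
      by rewrite addrC subrK.
    rewrite eP// -addrA; congr (_ + _).
    rewrite -sumrB mulr_sumr -sumrN; apply: eq_bigr => z _.
    rewrite /tderiv -[P z](proj1 (HQ z)) scalerBl !qpolyD -scaleNr !qpolyZ.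
    by ring.
  apply: has_MderiveB; first exact: dF.
  by apply: has_Mderive_sum => z; exact: has_Mderive_qpoly.
exists (fun z => Q z + (k *+ (z == c))%:P) => [z|t t0].
  have [_ sQ] := HQ z; rewrite (leq_trans (size_polyD _ _))// geq_max /=.
  apply/andP; split.
    by rewrite (leq_trans sQ)// addnC [z == c]eq_sym leq_add2l.
  rewrite eq_sym; case: eqP => _; last by rewrite mulr0n size_poly0.
  by rewrite (leq_trans (size_polyC_leq1 _)).
under eq_bigr do rewrite qpolyD.
rewrite big_split/= [X in _ + X](_ : _ = f t); last first.
  rewrite fk// (bigD1_seq c) ?sT ?mem_head//= eqxx mulr1n.
  rewrite [X in _ + X]big1; last first.
    by move=> z /negPf ->; rewrite mulr0n /qpoly horner0 mul0r.
  by rewrite addr0 /qpoly hornerC.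
by rewrite /f addrC subrK.
Qed.

(** If x^l e^(z x) = x^k e^(w x), comparing the logarithmic derivatives gives
l + z x = k + w x at all values x of X, and two of them suffice. *)
Lemma qpolyXn_inj (l k : nat) (z w : C) :
    (forall t : R, 0 < t -> qpoly 'X^l z t = qpoly 'X^k w t) -> (z, l) = (w, k).
Proof.
move=> e.
have main (t : R) : 0 < t -> (l%:R - k%:R) + (z - w) * (Mtime t)%:C = 0 :> C.
  move=> t0; have dl := @has_Mderive_qpoly _ _ _ alpha_gt0 beta_gt0 'X^l z t t0.
  have dk := @has_Mderive_qpoly _ _ _ alpha_gt0 beta_gt0 'X^k w t t0.
  have /has_MderiveE[_ e1] := eq_has_Mderive beta_gt0 e t0 dl.
  have /has_MderiveE[_ e2] := dk; move: e1; rewrite e2 !qpolyD !qpolyZ -(e t t0).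
  have x0 : (Mtime t)%:C != 0 :> C.
    by rewrite fmorph_eq0 gt_eqF// Mtime_gt0.
  have dX m v : qpoly ('X^m)^`() v t * (Mtime t)%:C = m%:R * qpoly 'X^m v t.
    rewrite /qpoly derivXn hornerMn !hornerXn; case: m => [|m].
      by rewrite mulr0n !mul0r.
    by rewrite exprS -mulr_natl; ring.
  move=> /(congr1 ( *%R^~ (Mtime t)%:C)); rewrite /= !mulrDl !dX -(e t t0) => e3.
  have y0 : qpoly 'X^l z t != 0.
    by rewrite mulf_neq0 ?cexp_neq0// hornerXn expf_neq0.
  apply: (mulIf y0); rewrite mul0r.
  move/eqP: e3; rewrite -subr_eq0 -oppr_eq0 => /eqP e3.
  by rewrite -[RHS]e3; ring.
have m1 := main 1 ltr01; have m2 := main 2 (ltr0Sn R 1).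
have : (z - w) * ((Mtime 2)%:C - (Mtime 1)%:C) = 0.
  by rewrite mulrBr -[RHS](subrr (0 : C)) -{1}m2 -m1; ring.
move=> /eqP; rewrite mulf_eq0 => /orP[|].
  rewrite subr_eq0 => /eqP zw; move: m1; rewrite zw subrr mul0r addr0 => /eqP.
  by rewrite subr_eq0 eqr_nat => /eqP ->.
rewrite -rmorphB fmorph_eq0 /Mtime -mulrBr mulf_eq0 gt_eqF/=; last first.
  by rewrite divr_gt0// Gamma_beta_gt0.
rewrite subr_eq0 gt_eqF//.
by apply: gt0_ltr_powR; rewrite ?nnegrE ?ltr1n.
Qed.

End QuasiPolynomials.

(** * The characteristic polynomial *)

Section CharPoly.
Variables (R : realType) (n : nat) (p : 'I_n -> R).
Local Notation C := R[i].
Local Notation q := (char_poly_of p).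

Let tail : {poly C} := \sum_(i < n) (p i)%:C *: 'X^i.

Let tail_size : (size tail < size ('X^n : {poly C}))%N.
Proof.
rewrite size_polyXn ltnS (leq_trans (size_sum _ _ _))//.
apply/bigmax_leqP => i _.
by rewrite (leq_trans (size_scale_leq _ _))// size_polyXn ltn_ord.
Qed.

Lemma size_char_poly_of : size q = n.+1.
Proof. by rewrite /char_poly_of (size_polyDl tail_size) size_polyXn. Qed.

Lemma monic_char_poly_of : q \is monic.
Proof. by rewrite monicE /char_poly_of (lead_coefDl tail_size) lead_coefXn. Qed.

Lemma char_poly_of_neq0 : q != 0.
Proof. exact: monic_neq0 monic_char_poly_of. Qed.

Lemma poly_act_char_poly_of (F : nat -> C) :
  poly_act (V := C^o) q F = F n + \sum_(i < n) (p i)%:C * F i.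
Proof.
have coef_tail j : tail`_j =
    \sum_(i < n) (p i)%:C * (j == i :> nat)%:R.
  by rewrite coef_sum; apply: eq_bigr => i _; rewrite coefZ coefXn.
rewrite /poly_act size_char_poly_of big_ord_recr/= addrC /char_poly_of -/tail.
congr (_ + _).
  rewrite coefD coefXn eqxx nth_default ?addr0 ?scale1r//.
  by have := tail_size; rewrite size_polyXn ltnS.
apply: eq_bigr => i _; rewrite coefD coefXn ltn_eqF// add0r coef_tail.
rewrite (bigD1 i)//= eqxx mulr1 big1 ?addr0// => j ji.
by rewrite [(_ == _ :> nat)](_ : _ = false) ?mulr0// eq_sym; exact/negbTE.
Qed.

Lemma char_poly_of_split : exists rs : seq C,
  [/\ q = \prod_(z <- rs) ('X - z%:P), size rs = n &
      forall c, count_mem c rs = mup c q].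
Proof.
have [rs] := closed_field_poly_normal q.
rewrite (monicP monic_char_poly_of) scale1r => E; exists rs; split => //.
  by have := size_char_poly_of; rewrite E size_prod_XsubC => -[].
by move=> c; rewrite E mup_prod_XsubC.
Qed.

End CharPoly.

(** * The fundamental set attached to the roots *)

Section FundamentalSet.
Variables (R : realType) (alpha beta : R).
Hypotheses (alpha_gt0 : 0 < alpha) (beta_gt0 : 0 < beta).
Variables (n : nat) (p : 'I_n -> R).
Local Notation C := R[i].
Local Notation q := (char_poly_of p).

Lemma MsolutionE y : Msolution alpha beta p y <->
  Mdifferentiablen alpha beta n y /\ forall t, 0 < t ->
    poly_act (V := C^o) q (fun i => Mderiven alpha beta i y t) = 0.
Proof.
split=> -[dy ey]; split=> // t t0; have := ey t t0;
  by rewrite poly_act_char_poly_of.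
Qed.

(** The factor (X - c) ^ (mup c q) of q already annihilates P. *)
Lemma Msolution_qpoly (P : {poly C}) (c : C) : (size P <= mup c q)%N ->
  Msolution alpha beta p (qpoly alpha beta P c).
Proof.
move=> sP; apply/MsolutionE; split=> [i _ t t0|t t0].
  exact: (Mderiven_qpoly alpha_gt0 beta_gt0 P c i).2.
rewrite (@eq_poly_act _ _ _ _
  (fun i => qpoly alpha beta (iter i (tderiv c) P) c t)).
  rewrite poly_act_qpoly.
  have : ('X - c%:P) ^+ mup c q %| q by rewrite -mup_geq// char_poly_of_neq0.
  move=> /dvdpP[q' qE]; rewrite [X in poly_act X]qE poly_act_tderiv_eq0//.
  by rewrite /qpoly horner0 mul0r.
by move=> i; exact: (Mderiven_qpoly alpha_gt0 beta_gt0 P c i).1.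
Qed.

(** The pair (c, l) stands for the function x^l e^(c x). *)
Definition root_exponents (T : seq C) : seq (C * nat) :=
  [seq (c, l) | c <- T, l <- iota 0 (mup c q)].

Lemma size_root_exponents T : size (root_exponents T) = (\sum_(c <- T) mup c q)%N.
Proof.
rewrite size_allpairs_dep sumnE big_map.
by apply: eq_bigr => c _; rewrite size_iota.
Qed.

Lemma mem_root_exponents T c l :
  ((c, l) \in root_exponents T) = (c \in T) && (l < mup c q)%N.
Proof.
apply/allpairsPdep/andP => [[x [y [xT + [-> ->]]]]|[cT lc]].
  by rewrite mem_iota.
by exists c, l; rewrite cT mem_iota.
Qed.

Lemma uniq_root_exponents T : uniq T -> uniq (root_exponents T).
Proof.
move=> uT; apply: allpairs_uniq_dep => //; first by move=> c _; exact: iota_uniq.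
by move=> [c l] [d k] _ _ /= [-> ->].
Qed.

(** The multiplicities along T add up to the degree of q, so T contains all
roots of q and [qpoly_span] applies to the full factorization of q. *)
Lemma fundamental_set_root_exponents (T : seq C) : uniq T ->
    (\sum_(c <- T) mup c q = n)%N ->
  fundamental_set alpha beta p
    [set f | exists2 cl, cl \in root_exponents T &
                         f = qpoly alpha beta 'X^(cl.2) cl.1].
Proof.
move=> uT sT; set L := root_exponents T.
have sL : size L = n by rewrite size_root_exponents.
pose cl (i : 'I_n) : C * nat := nth (0, 0%N) L i.
have clL i : cl i \in L by rewrite mem_nth// sL.
have [rs [qE szrs cnt]] := char_poly_of_split p.
have rsT : {subset rs <= T}.
  have : count [in T] rs = size rs.
    rewrite -(sum_count_mem rs uT) szrs -[RHS]sT; apply: eq_bigr => c _.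
    by rewrite cnt.
  by move=> /eqP; rewrite -all_count => /allP.
exists (fun i => qpoly alpha beta 'X^((cl i).2) (cl i).1); split.
- apply/seteqP; split=> [f [x xL ->]|_ [i _ <-]]; last by exists (cl i).
  have iL : (index x L < n)%N by rewrite -sL index_mem.
  by exists (Ordinal iL) => //; rewrite /cl /= nth_index.
- move=> i j /(qpolyXn_inj alpha_gt0 beta_gt0).
  rewrite -!surjective_pairing => /eqP.
  by rewrite nth_uniq ?sL ?uniq_root_exponents// => /eqP /val_inj.
- move=> i; apply: Msolution_qpoly; rewrite size_polyXn.
  have := clL i; rewrite [cl i]surjective_pairing mem_root_exponents.
  by case/andP.
- move=> z /MsolutionE[dz ez].
  have [|t t0|P sP eP] := qpoly_span alpha_gt0 beta_gt0 uT
      (F := fun i => Mderiven alpha beta i z) rsT.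
  - by move=> i t; rewrite szrs => iN t0; exact: dz.
  - by rewrite -qE; exact: ez.
  exists (fun i => (P (cl i).1)`_(cl i).2) => t t0; rewrite [LHS](eP t t0).
  transitivity (\sum_(x <- L) (P x.1)`_x.2 * qpoly alpha beta 'X^(x.2) x.1 t).
    rewrite /L /root_exponents big_allpairs_dep/=; apply: eq_bigr => c _.
    rewrite /qpoly (@horner_coef_wide _ (mup c q)) -?cnt// mulr_suml.
    rewrite /index_iota -[in RHS](subn0 (count_mem c rs)) -/(index_iota 0 _).
    rewrite big_mkord.
    by apply: eq_bigr => l _; rewrite hornerXn mulrA.
  by rewrite (big_nth (0, 0%N)) sL big_mkord.
Qed.

End FundamentalSet.

Theorem theorem4p1 (R : realType) (n : nat) (alpha beta : R) (p : 'I_n -> R)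
    (k m : nat) (r : 'I_k -> R[i]) (mu : 'I_k -> nat)
    (a b : 'I_m -> R) (sigma : 'I_m -> nat)
    (n_ge1 : (1 <= n)%N)
    (alpha_gt0 : 0 < alpha) (alpha_le1 : alpha <= 1) (beta_gt0 : 0 < beta)
    (b_neq0 : forall j, b j != 0)
    (r_root : forall j, root_of_mult (char_poly_of p) (r j) (mu j))
    (lambda_root : forall j,
      root_of_mult (char_poly_of p) (a j +i* b j) (sigma j))
    (conj_lambda_root : forall j,
      root_of_mult (char_poly_of p) (a j -i* b j) (sigma j))
    (roots_distinct : uniq ([seq r j | j <- enum 'I_k]
                         ++ [seq a j +i* b j | j <- enum 'I_m]
                         ++ [seq a j -i* b j | j <- enum 'I_m]))
    (sum_mult : (\sum_(j < k) mu j + 2 * \sum_(j < m) sigma j = n)%N) :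
  let X := fun t : R => Gamma (beta + 1) / alpha * t `^ alpha in
  fundamental_set alpha beta p
    ((\bigcup_(j in [set: 'I_k])
        [set (fun t : R => (X t ^+ l)%:C * cexp (r j * (X t)%:C))
          | l in [set l : nat | (l < mu j)%N]])
     `|` (\bigcup_(j in [set: 'I_m])
        [set (fun t : R => (X t ^+ l)%:C * (expR (a j * X t))%:C
               * ((cos (b j * X t))%:C + 'i%C * (sin (b j * X t))%:C))
          | l in [set l : nat | (l < sigma j)%N]])
     `|` (\bigcup_(j in [set: 'I_m])
        [set (fun t : R => (X t ^+ l)%:C * (expR (a j * X t))%:C
               * ((cos (b j * X t))%:C - 'i%C * (sin (b j * X t))%:C))
          | l in [set l : nat | (l < sigma j)%N]])).
Proof.
move=> X; set T := _ ++ _ in roots_distinct.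
have mu_r j : mup (r j) (char_poly_of p) = mu j by case: (r_root j).
have mu_l j : mup (a j +i* b j) (char_poly_of p) = sigma j.
  by case: (lambda_root j).
have mu_c j : mup (a j -i* b j) (char_poly_of p) = sigma j.
  by case: (conj_lambda_root j).
have sT : (\sum_(c <- T) mup c (char_poly_of p) = n)%N.
  have block d (f : 'I_d -> R[i]) (s : 'I_d -> nat) :
      (forall j, mup (f j) (char_poly_of p) = s j) ->
      (\sum_(c <- [seq f j | j <- enum 'I_d]) mup c (char_poly_of p) =
       \sum_(j < d) s j)%N.
    move=> fs; rewrite big_map; under eq_bigr do rewrite fs.
    exact: big_enum.
  apply: (etrans _ sum_mult).
  rewrite /T 2!big_cat (block _ _ mu mu_r) (block _ _ sigma mu_l).
  by rewrite (block _ _ sigma mu_c) mul2n -addnn.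
have f_r l j : qpoly alpha beta 'X^l (r j) =
    (fun t : R => (X t ^+ l)%:C * cexp (r j * (X t)%:C)).
  by apply/funext => t; rewrite /qpoly hornerXn rmorphXn.
have f_l l j : qpoly alpha beta 'X^l (a j +i* b j) =
    (fun t : R => (X t ^+ l)%:C * (expR (a j * X t))%:C
               * ((cos (b j * X t))%:C + 'i%C * (sin (b j * X t))%:C)).
  by apply/funext => t; rewrite /qpoly hornerXn rmorphXn cexpE mulrA.
have f_c l j : qpoly alpha beta 'X^l (a j -i* b j) =
    (fun t : R => (X t ^+ l)%:C * (expR (a j * X t))%:C
               * ((cos (b j * X t))%:C - 'i%C * (sin (b j * X t))%:C)).
  apply/funext => t; rewrite /qpoly hornerXn rmorphXn cexpE mulrA /=.
  by rewrite mulNr cosN sinN rmorphN mulrN.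
have := fundamental_set_root_exponents alpha_gt0 beta_gt0 roots_distinct sT.
congr fundamental_set; apply/seteqP; split=> [f [[c l]]|f [[]|]].
- rewrite mem_root_exponents /T !mem_cat => /andP[/or3P[]] /mapP[j _ ->] lj ->.
  + by left; left; exists j => //; exists l; rewrite /= -?mu_r ?f_r.
  + by left; right; exists j => //; exists l; rewrite /= -?mu_l ?f_l.
  + by right; exists j => //; exists l; rewrite /= -?mu_c ?f_c.
- move=> [j _ [l /= lj <-]]; exists (r j, l); last by rewrite f_r.
  by rewrite mem_root_exponents mu_r lj andbT !mem_cat map_f// mem_enum.
- move=> [j _ [l /= lj <-]]; exists (a j +i* b j, l); last by rewrite f_l.
  rewrite mem_root_exponents mu_l lj andbT !mem_cat.
  by rewrite (map_f _ (mem_enum _ _)) ?orbT.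
- move=> [j _ [l /= lj <-]]; exists (a j -i* b j, l); last by rewrite f_c.
  rewrite mem_root_exponents mu_c lj andbT !mem_cat.
  by rewrite (map_f _ (mem_enum _ _)) ?orbT.
Qed.
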